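(* If $M=(E,G)$ is an $AI_4$-free matroid, then there exists a hyperplane $H$ of $G$ such that either $E$ or $G\setminus E$ is contained in either $H$ or $G\setminus H$; that is, at least one of the following holds: (1) $E\subseteq H$; (2) $G\setminus E\subseteq H$; (3) $E\cap H=\varnothing$; (4) $H\subseteq E$.
   Context: A matroid here means a pair $M=(E,G)$, where $G=\mathrm{PG}(n-1,2)$ is identified with $\mathbb F_2^n\setminus\{0\}$ ($n\ge 1$) and $E\subseteq G$ is arbitrary. A flat of $G$ is a set $F\subseteq G$ with $F\cup\{0\}$ a linear subspace (the empty set is the flat of dimension $0$); a hyperplane is a maximal proper flat. $M=(E,G)$ is $AI_4$-free if for every linearly independent set $\{x_1,x_2,x_3,x_4\}\subseteq E$ of four elements there is some $i\in\{1,2,3,4\}$ with $\sum_{j\ne i}x_j\in E$. *)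

(* Defs.v *)
From HB Require Import structures.
From mathcomp Require Import all_boot all_order all_algebra.

Set Implicit Arguments.
Unset Strict Implicit.
Unset Printing Implicit Defensive.

Import GRing.Theory.
Local Open Scope ring_scope.

(* The projective geometry PG(n-1, 2), identified with F_2^n minus 0. *)
Definition PG (n : nat) : {set 'rV['F_2]_n} := [set x | x != 0].

Definition flat (n : nat) (F : {set 'rV['F_2]_n}) : Prop :=
  F \subset PG n /\
  exists V : {vspace 'rV['F_2]_n}, 0 |: F = [set x | x \in V].

Definition hyperplane (n : nat) (H : {set 'rV['F_2]_n}) : Prop :=
  [/\ flat H, H \proper PG n &
      forall F : {set 'rV['F_2]_n},
        flat F -> F \proper PG n -> H \subset F -> F = H].

(* A matroid (E, G) is represented by its ground set E, a subset of PG n.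
   Since [free] excludes repeated entries, a free 4-tuple is an ordered
   listing of a linearly independent set of exactly four elements. *)
Definition AI4_free (n : nat) (E : {set 'rV['F_2]_n}) : Prop :=
  forall x : 4.-tuple 'rV['F_2]_n,
    free x -> {subset x <= E} ->
    exists i : 'I_4, \sum_(j < 4 | j != i) tnth x j \in E.

(* Main.v *)
Require Import Defs.
From HB Require Import structures.
From mathcomp Require Import all_boot all_order all_algebra.
From mathcomp Require Import ring.

Set Implicit Arguments.
Unset Strict Implicit.
Unset Printing Implicit Defensive.

Import GRing.Theory.
Local Open Scope ring_scope.

(* Viewed on affine 3-flats missing 0, AI4-freeness forbids E to meet such a
   flat in four points whose sum is not 0, which is invariant under complement.
   We show by induction on a subspace A that, up to the value at 0, the
   indicator f of E is constant on half of each coset c + A.  A hyperplane of A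
   has a coset missing 0, so by induction f is constant, say 0, on c + W with W
   of index 4 in A.  Let E meet the other three cosets of W in translates of Y,
   Z and T.  In any direction u of W, one of them having two points of E on a
   line of direction u while the other two have lines with exactly one is
   forbidden; so the differences of each set lie in the union of the stabilisers
   of the other two.  As a subspace is not the union of two proper ones, either
   two of the sets are all of W, or all differences lie in one proper subspace
   of W, and then halves of the four cosets avoiding E fit together. *)

(** * Vectors over F_2, subgroups and index 2 *)

Lemma F2_cases (a : 'F_2) : a = 0 \/ a = 1.
Proof. by case: a => [[|[|//]]] ?; [left|right]; apply: val_inj. Qed.

Ltac char2 :=
  apply/rowP => ?; rewrite !mxE;
  repeat match goal with |- context [fun_of_matrix ?x ?i ?j] =>
    case: (F2_cases (fun_of_matrix x i j)) => -> end;
  exact: val_inj.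

Section Subgroups.

Variable n : nat.
Local Notation V := 'rV['F_2]_n.
Implicit Types (A B S W X Y Z T : {set V}) (u v w x y z c h : V).

Lemma addvv x : x + x = 0. Proof. char2. Qed.

Lemma addvK2 x y : x + y + y = x. Proof. char2. Qed.

Lemma addv_eq0 x y : (x + y == 0) = (x == y).
Proof.
apply/eqP/eqP => [e|->]; last exact: addvv.
by rewrite -[x](addvK2 x y) e add0r.
Qed.

(** Over F_2 these are exactly the linear subspaces: opposites and scalar multiples come for
    free. *)
Definition subgroup S := 0 \in S /\ {in S &, forall x y, x + y \in S}.

Lemma subgroupDl S x y : subgroup S -> x \in S -> (x + y \in S) = (y \in S).
Proof.
move=> [_ SD] xS; apply/idP/idP => [xyS|]; last exact: SD.
by rewrite (_ : y = x + (x + y)); [apply: SD|char2].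
Qed.

Lemma subgroupDr S x y : subgroup S -> x \in S -> (y + x \in S) = (y \in S).
Proof. by move=> Sg xS; rewrite addrC subgroupDl. Qed.

(** Fix x in S outside A, hence in B. For y in S, either x + y is in B and so is y, or x + y is in
    A, which keeps y out of A and so puts it in B. *)
Lemma subgroup_cover A B S : subgroup A -> subgroup B -> subgroup S ->
  {in S, forall x, x \in A \/ x \in B} -> S \subset A \/ S \subset B.
Proof.
move=> Ag Bg Sg cov; case: (boolP (S \subset A)) => [|/subsetPn[x xS xA]]; first by left.
right; apply/subsetP => y yS.
have xB : x \in B by case: (cov x xS) => // /(negP xA).
case: (cov (x + y) (Sg.2 _ _ xS yS)) => [xyA|]; last by rewrite (subgroupDl _ Bg xB).
case: (cov y yS) => // yA.
by move: xyA; rewrite subgroupDr // (negPf xA).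
Qed.

Definition index2 B A := [/\ subgroup B, B \subset A &
  exists2 v, v \in A :\: B & {in A, forall x, x \in B \/ x + v \in B}].

Lemma index2_cover B A v x : subgroup A -> index2 B A ->
  v \in A -> v \notin B -> x \in A -> x \in B \/ x + v \in B.
Proof.
move=> Ag [Bg BA [w /setDP[wA wB] cov]] vA vB xA.
case: (cov x xA) => [|xw]; [by left|right].
case: (cov v vA) => [|vw]; first by rewrite (negPf vB).
by rewrite (_ : x + v = (x + w) + (v + w)); [apply: Bg.2|char2].
Qed.

(** In characteristic 2 the two cosets S and S + y already make up the subgroup generated by S and
    y. *)
Definition adjoin S y := [set x | (x \in S) || (x + y \in S)].

Lemma adjoin_subgroup S y : subgroup S -> subgroup (adjoin S y).
Proof.
move=> Sg; split; first by rewrite inE Sg.1.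
move=> u v; rewrite !inE => /orP[] uS /orP[] vS.
- by rewrite (Sg.2 _ _ uS vS).
- by rewrite -addrA (Sg.2 _ _ uS vS) orbT.
- by rewrite addrAC (Sg.2 _ _ uS vS) orbT.
- by rewrite (_ : u + v = u + y + (v + y)); [rewrite (Sg.2 _ _ uS vS)|char2].
Qed.

Lemma sub_adjoin S y : S \subset adjoin S y.
Proof. by apply/subsetP => x xS; rewrite inE xS. Qed.

Lemma adjoin_sub S A y : subgroup A -> S \subset A -> y \in A -> adjoin S y \subset A.
Proof.
move=> Ag /subsetP SA yA; apply/subsetP => x; rewrite inE => /orP[/SA//|/SA].
by rewrite subgroupDr.
Qed.

(** Take B maximal among the proper subgroups of W above U: adjoining any v of W outside B must then
    give all of W. *)
Lemma index2_above U W : subgroup U -> subgroup W -> U \proper W ->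
  exists2 B, index2 B W & U \subset B.
Proof.
move=> Ug Wg UW.
pose P S := [&& 0 \in S, [forall x in S, forall y in S, x + y \in S] & S \proper W].
have PE S : P S -> subgroup S /\ S \proper W.
  case/and3P => S0 /forall_inP SD SW; split=> //; split=> // x y xS yS.
  by have /forall_inP := SD _ xS; apply.
have EP S : subgroup S -> S \proper W -> P S.
  case=> S0 SD SW; apply/and3P; split=> //.
  by apply/forall_inP => x xS; apply/forall_inP => y yS; apply: SD.
have [B /maxsetP[PB Bmax] UB] := maxset_exists (EP _ Ug UW).
have [Bg /properP[BW [v vW vB]]] := PE _ PB.
exists B => //; split=> //; exists v; first by rewrite inE vB.
move=> x xW; have [B'W|] := boolP (adjoin B v \proper W).
  have vB' : v \in adjoin B v by rewrite inE addvv Bg.1 orbT.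
  by move: vB; rewrite -(Bmax _ (EP _ (adjoin_subgroup v Bg) B'W) (sub_adjoin _ _)) vB'.
rewrite properE adjoin_sub // negbK => /subsetP/(_ _ xW); rewrite inE.
by move/orP.
Qed.

(** * Stabilisers and differences of subsets of a subgroup *)

(* Here h stands for the point of W translated to 0, where the value of the
   indicator is meaningless; it lies outside W for cosets missing 0. *)
Definition stab W X h := [set u in W | [forall w in W,
  (w != h) ==> (w + u != h) ==> ((w + u \in X) == (w \in X))]].

Lemma stabP W X h u : reflect (u \in W /\ forall w, w \in W -> w != h -> w + u != h ->
  (w + u \in X) = (w \in X)) (u \in stab W X h).
Proof.
rewrite inE; apply: (iffP andP) => -[uW H]; split=> //.
  by move=> w wW h1 h2; move/forall_inP: H => /(_ _ wW); rewrite h1 h2 => /eqP.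
apply/forall_inP => w wW; apply/implyP => h1; apply/implyP => h2.
by rewrite H.
Qed.

Lemma stab_sub W X h : stab W X h \subset W.
Proof. by apply/subsetP => u /stabP[]. Qed.

(* Between w and w + u + v one can pass through w + u or through w + v, and
   only one of these can be the hole h. *)
Lemma stab_subgroup W X h : subgroup W -> subgroup (stab W X h).
Proof.
move=> Wg; split; first by apply/stabP; split=> [|w *]; rewrite ?Wg.1 ?addr0.
move=> u v /stabP[uW Hu] /stabP[vW Hv].
apply/stabP; split=> [|w wW wh]; first exact: Wg.2.
case: (eqVneq (w + u) h) => [e|uh]; last first.
  by rewrite addrA => H; rewrite Hv ?Hu // Wg.2.
case: (eqVneq (w + v) h) => [e'|vh] H.
  have -> : u = v by apply: (addrI w); rewrite e.
  by rewrite addvv addr0.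
have E : w + (u + v) = w + v + u by rewrite (addrC u) addrA.
by rewrite E Hu ?Hv -?E // Wg.2.
Qed.

Definition diff X u := exists2 x, x \in X & x + u \in X.

(** W acts transitively on itself, so a single translation takes a point p of X to any w other than
    the hole. *)
Lemma stab_full W X h : subgroup W -> X \subset W -> X != set0 -> h \notin X ->
  W \subset stab W X h -> W :\ h \subset X.
Proof.
move=> Wg XW /set0Pn[p pX] hX WS; apply/subsetP => w /setD1P[wh wW].
have pW := subsetP XW _ pX.
have /stabP[_ /(_ p pW)] := subsetP WS _ (Wg.2 _ _ pW wW).
rewrite (_ : p + (p + w) = w); last by char2.
rewrite wh pX => -> //.
by apply: contraNneq hX => <-.
Qed.

Lemma stab_diff W X h u : X \subset W -> X != set0 -> h \notin W ->
  subgroup W -> u \in stab W X h -> diff X u.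
Proof.
move=> XW /set0Pn[x xX] hW Wg /stabP[uW H]; exists x => //.
have xW := subsetP XW _ xX.
rewrite H //; apply: contraNneq hW => <- //; exact: Wg.2.
Qed.

Lemma diff_stab W X h u v : X \subset W -> h \notin W -> subgroup W ->
  diff X v -> u \in stab W X h -> diff X (v + u).
Proof.
move=> XW hW Wg [x xX xvX] /stabP[uW H]; exists x => //.
have xW := subsetP XW _ xvX.
rewrite addrA H //; apply: contraNneq hW => <- //; exact: Wg.2.
Qed.

(** Since [hY] and [hZ] lie outside W, elements of [SY] and [SZ] are themselves differences, so
    [subgroup_cover] compares the stabilisers. Either [ST] contains the other two, or [SY] and [SZ]
    coincide. Nothing is said about [hT]: the third coset may contain 0. *)
Lemma common_stab W Y Z T hY hZ hT : subgroup W ->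
  Y \subset W -> Z \subset W -> hY \notin W -> hZ \notin W -> Y != set0 -> Z != set0 ->
  let SY := stab W Y hY in let SZ := stab W Z hZ in let ST := stab W T hT in
  (forall u, diff T u -> u \in SY \/ u \in SZ) ->
  (forall u, diff Y u -> u \in ST \/ u \in SZ) ->
  (forall u, diff Z u -> u \in ST \/ u \in SY) ->
  exists2 S, S \in [:: SY; ST] &
    forall u, diff Y u \/ diff Z u \/ diff T u -> u \in S.
Proof.
move=> Wg YW ZW hYW hZW Y0 Z0 SY SZ ST dT dY dZ.
have SYg : subgroup SY := stab_subgroup _ _ Wg.
have SZg : subgroup SZ := stab_subgroup _ _ Wg.
have STg : subgroup ST := stab_subgroup _ _ Wg.
have cY : SY \subset ST \/ SY \subset SZ.
  by apply: subgroup_cover => // u uS; apply: dY; apply: stab_diff uS.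
have cZ : SZ \subset ST \/ SZ \subset SY.
  by apply: subgroup_cover => // u uS; apply: dZ; apply: stab_diff uS.
case: (boolP ((SY \subset ST) && (SZ \subset ST))) => [/andP[YT ZT]|nT].
  exists ST; first by rewrite !inE eqxx orbT.
  by move=> u [/dY|[/dZ|/dT]] [] //; apply: subsetP.
have {cY cZ} : SY = SZ /\ ~~ (SY \subset ST).
  case: cY cZ nT => [YT|YZ] [ZT|ZY].
  - by rewrite YT ZT.
  - by rewrite YT (subset_trans ZY YT).
  - by rewrite ZT (subset_trans YZ ZT).
  - by have -> : SY = SZ; [apply/eqP; rewrite eqEsubset YZ|rewrite andbb].
case=> YZ /subsetPn[s sY sT].
(* Adding s to a difference u in [ST] gives a difference outside [ST], which forces u + s, and hence
   u, into [SY]. *)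
have red X hX : stab W X hX = SY -> X \subset W -> hX \notin W ->
    (forall u, diff X u -> u \in ST \/ u \in SY) -> forall u, diff X u -> u \in SY.
  move=> eX XW hXW dX u du; case: (dX u du) => // uT.
  have /dX[] : diff X (u + s) by apply: (diff_stab XW hXW Wg du); rewrite eX.
    by rewrite (subgroupDl _ STg uT) (negPf sT).
  by rewrite (subgroupDr _ SYg sY).
exists SY; first by rewrite inE eqxx.
move=> u [|[|/dT[]]]; last by rewrite YZ.
- by apply: (red Y hY) => // v /dY[]; [left|rewrite -YZ; right].
- exact: (red Z hZ).
- by [].
Qed.

(** If Y or Z is stabilised by W, it is all of W and every u is one of its differences, so the other
    two stabilisers cover W and one of them is W. Otherwise [common_stab] applies, except that its S
    could be the stabiliser of T when that is W. *)
Lemma full_or_common W Y Z T hY hZ hT : subgroup W ->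
  Y \subset W -> Z \subset W -> T \subset W ->
  hY \notin W -> hZ \notin W -> hT \notin T -> Y != set0 -> Z != set0 -> T != set0 ->
  (forall u, diff T u -> u \in stab W Y hY \/ u \in stab W Z hZ) ->
  (forall u, diff Y u -> u \in stab W T hT \/ u \in stab W Z hZ) ->
  (forall u, diff Z u -> u \in stab W T hT \/ u \in stab W Y hY) ->
  [\/ W \subset Y /\ W \subset Z, W \subset Y /\ W :\ hT \subset T,
      W \subset Z /\ W :\ hT \subset T |
      exists S, [/\ subgroup S, S \proper W &
        forall u, diff Y u \/ diff Z u \/ diff T u -> u \in S]].
Proof.
move=> Wg YW ZW TW hYW hZW hTT Y0 Z0 T0 dT dY dZ.
have fullE X h : X \subset W -> h \notin W -> X != set0 -> W \subset stab W X h -> W \subset X.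
  move=> XW hW X0 WS; have hX : h \notin X by apply: contraNN hW; apply: subsetP.
  apply: subset_trans (stab_full Wg XW X0 hX WS); apply/subsetP => w wW.
  by rewrite !inE wW andbT; apply: contraNneq hW => <-.
have fullT : W \subset stab W T hT -> W :\ hT \subset T by exact: stab_full.
have alld X : W \subset X -> {in W, forall u, diff X u}.
  by move=> WX u uW; exists 0; rewrite ?add0r; apply: (subsetP WX) => //; apply: Wg.1.
have sg X h : subgroup (stab W X h) by exact: stab_subgroup.
case: (boolP (W \subset stab W Y hY)) => [WSY|nY].
  have WY := fullE _ _ YW hYW Y0 WSY.
  have [|/fullT|/(fullE _ _ ZW hZW Z0)] := subgroup_cover (sg T hT) (sg Z hZ) Wg.
  - by move=> u uW; apply/dY/(alld _ WY).
  - by constructor 2.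
  - by constructor 1.
case: (boolP (W \subset stab W Z hZ)) => [WSZ|nZ].
  have WZ := fullE _ _ ZW hZW Z0 WSZ.
  have [|/fullT|] := subgroup_cover (sg T hT) (sg Y hY) Wg.
  - by move=> u uW; apply/dZ/(alld _ WZ).
  - by constructor 3.
  - by rewrite (negPf nY).
constructor 4.
case: (boolP (W \subset stab W T hT)) => [/fullT WT|nT].
  (* Here T misses at most [hT], but some u is not a difference of T. This leaves room in W only for
     [hT] and [hT + u], and S is trivial. *)
  have /subsetPn[u uW] : ~~ (W \subset stab W Y hY :|: stab W Z hZ).
    apply/negP => /subsetP cov; have [|/idPn[]|/idPn[]] := subgroup_cover (sg Y hY) (sg Z hZ) Wg => //.
    by move=> u /cov; rewrite inE => /orP.
  rewrite inE negb_or => /andP[uY uZ].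
  have ndT : ~ diff T u by move=> /dT[]; apply/negP.
  have W2 w : w \in W -> w = hT \/ w = hT + u.
    move=> wW; case: (eqVneq w hT) => [|wh]; [by left|right].
    case: (eqVneq (w + u) hT) => [<-|wuh]; first by rewrite addvK2.
    case: ndT; exists w; apply: (subsetP WT); rewrite !inE ?wh ?wuh ?Wg.2 //.
  exists [set 0]; split.
  - by split=> [|x y /set1P-> /set1P->]; rewrite ?addr0 set11.
  - rewrite properE sub1set Wg.1; apply/subsetPn; exists u => //.
    by rewrite inE; apply: contraNneq uY => ->; case: (sg Y hY).
  (* Two distinct points of X would exhaust W, and then u would stabilise X. *)
  have d2 X h v : X \subset W -> u \notin stab W X h -> diff X v -> v \in [set 0].
    move=> XW uX [x xX xvX]; rewrite inE; apply: contraNT uX => v0.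
    have WX w : w \in W -> w \in X.
      have : x + v != x by rewrite -[X in _ != X]addr0 (inj_eq (addrI x)).
      move: (x + v) xvX => y yX yx /W2 W2w; move: yx.
      move: (W2 _ (subsetP XW _ xX)) (W2 _ (subsetP XW _ yX)) W2w.
      by move=> [] e1 [] e2 [] ->; rewrite ?(esym e1, esym e2) // e1 e2 eqxx.
    by apply/stabP; split=> // w wW _ _; rewrite !WX // Wg.2.
  move=> v [|[|]]; [exact: d2 uY|exact: d2 uZ|].
  case=> x xT xvT.
  have E y : y \in T -> y = hT + u.
    move=> yT; case: (W2 _ (subsetP TW _ yT)) => // e.
    by rewrite -e yT in hTT.
  by rewrite inE -(inj_eq (addrI x)) addr0 (E _ xT) -{1}(E _ xT) (E _ xvT).
have [S inS dS] := common_stab Wg YW ZW hYW hZW Y0 Z0 dT dY dZ.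
exists S; split=> //.
- by move: inS; rewrite !inE => /orP[] /eqP->.
- by move: inS; rewrite properE !inE => /orP[] /eqP->; rewrite stab_sub.
Qed.


(** * The forbidden configuration and its traces on cosets *)

(** The four points and their triple sums fill an affine 3-flat missing 0. Quantifying over [b]
    builds the symmetry under complement into the definition. *)
Definition AI4_avoiding (f : V -> bool) := forall (b : bool) (x y z t : V),
  free [:: x; y; z; t] -> {in [:: x; y; z; t], f =1 fun=> b} ->
  {in [:: x + y + z; x + y + t; x + z + t; y + z + t], f =1 fun=> ~~ b} -> False.

Lemma free4P x y z (t : V) : reflect
  (forall a b c d : 'F_2, a *: x + b *: y + c *: z + d *: t = 0 -> [/\ a = 0, b = 0, c = 0 & d = 0])
  (free [:: x; y; z; t]).
Proof.
apply: (iffP (freeP (X := in_tuple [:: x; y; z; t]))) => [fr a b c d e|fr k].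
  have := fr (fun i => [:: a; b; c; d]`_i).
  rewrite !big_ord_recl big_ord0 /= addr0 !addrA => /(_ e) k0.
  by split; [exact: (k0 (@Ordinal 4 0 isT))|exact: (k0 (@Ordinal 4 1 isT))
            |exact: (k0 (@Ordinal 4 2 isT))|exact: (k0 (@Ordinal 4 3 isT))].
rewrite !big_ord_recl big_ord0 /= addr0 !addrA => /fr[k0 k1 k2 k3] i.
case: i => -[|[|[|[|//]]]] ?; [rewrite -[RHS]k0|rewrite -[RHS]k1|rewrite -[RHS]k2|rewrite -[RHS]k3];
  by congr k; apply: val_inj.
Qed.

(** Over F_2 a linear relation is a vanishing subset sum, so it suffices to exclude the fifteen
    nonempty subsets. *)
Lemma free4 x y z t : x != 0 -> y != 0 -> z != 0 -> t != 0 ->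
  x + y != 0 -> x + z != 0 -> x + t != 0 -> y + z != 0 -> y + t != 0 -> z + t != 0 ->
  x + y + z != 0 -> x + y + t != 0 -> x + z + t != 0 -> y + z + t != 0 ->
  x + y + z + t != 0 -> free [:: x; y; z; t].
Proof.
move=> *; apply/free4P => a b c d.
by case: (F2_cases a) => ->; case: (F2_cases b) => ->;
  case: (F2_cases c) => ->; case: (F2_cases d) => ->;
  rewrite ?scale0r ?scale1r ?add0r ?addr0 => /eqP e;
  by [split | exfalso; apply: negP e].
Qed.

(** A line of direction u with exactly one point in X is read starting from that point. *)
Lemma stabPn W X h u : subgroup W -> u \in W -> u \notin stab W X h ->
  exists w, [/\ w \in W, w != h, w + u != h, w \in X & w + u \notin X].
Proof.
move=> Wg uW; rewrite inE uW /= => /forall_inPn[w wW].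
rewrite !negb_imply => /and3P[wh wuh]; case: (boolP (w \in X)) => [wX|wX].
  by rewrite eqb_id => wuX; exists w.
rewrite eqbF_neg negbK => wuX; exists (w + u).
by rewrite addvK2; split=> //; apply: Wg.2.
Qed.

(** The coset is moved back to W. The hole [c + y] is the point that lands on 0; removing it makes
    the trace independent of [f 0]. *)
Definition trace W f c y := [set w in W | (w != c + y) && f (c + y + w)].

(** Otherwise take a line p, p + u with both points in E, and points q, r of E in the other two
    cosets with q + u, r + u outside E. The triple sums of p, p + u, q, r are q + u, r + u and two
    points of c + W, so all are outside E. *)
Lemma diff_trace f W c y z u : AI4_avoiding f -> subgroup W ->
  {in W, forall w, f (c + w) = false} -> c \notin W ->
  y \notin W -> z \notin W -> y + z \notin W -> diff (trace W f c y) u ->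
  u \in stab W (trace W f c z) (c + z) \/ u \in stab W (trace W f c (y + z)) (c + (y + z)).
Proof.
move=> fP Wg f0 cW yW zW yzW [w1].
rewrite {1}inE => /and3P[w1W w1h fw1]; rewrite {1}inE => /and3P[w1uW w1uh fw1u].
have uW : u \in W by move: w1uW; rewrite subgroupDl.
case: (eqVneq u 0) => [->|u0]; first by left; apply: (stab_subgroup _ _ Wg).1.
case: (boolP (u \in stab W (trace W f c z) (c + z))) => [|uz]; first by left.
case: (boolP (u \in stab W (trace W f c (y + z)) (c + (y + z)))) => [|ut]; first by right.
exfalso.
have [w2 [w2W w2h w2uh]] := stabPn Wg uW uz.
have [w3 [w3W w3h w3uh]] := stabPn Wg uW ut.
rewrite !inE w2W w3W w2h w3h w2uh w3uh !Wg.2 //= => fw3 /negbTE fw3u fw2 /negbTE fw2u.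
pose p := c + y + w1; pose q := c + z + w2; pose r := c + (y + z) + w3.
have neq0 v w : w != v -> v + w != 0 by rewrite addv_eq0 eq_sym.
have nW v w : w \in W -> v \notin W -> v + w != 0.
  by move=> wW; apply: contraNneq => /eqP; rewrite addv_eq0 => /eqP->.
have W3 : w1 + w2 + w3 \in W by rewrite !Wg.2.
have W3u : w1 + w2 + w3 + u \in W by rewrite Wg.2.
have e1 : p + (p + u) + q = c + z + (w2 + u) by rewrite /p /q; char2.
have e2 : p + (p + u) + r = c + (y + z) + (w3 + u) by rewrite /p /r; char2.
have e3 : p + q + r = c + (w1 + w2 + w3) by rewrite /p /q /r; char2.
have e4 : p + u + q + r = c + (w1 + w2 + w3 + u) by rewrite /p /q /r; char2.
apply: (fP true p (p + u) q r).
(* Odd sums avoid 0 because the holes are excluded or because c is outside W. Even sums lie in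
   nontrivial cosets of W, except p + (p + u) = u. *)
- apply: free4; rewrite ?e1 ?e2 ?e3 ?e4; try exact: neq0; try exact: nW.
  + by rewrite /p -addrA neq0.
  + by rewrite (_ : p + (p + u) = u); [|char2].
  + by rewrite (_ : p + q = y + z + (w1 + w2)); [apply: nW; rewrite // !Wg.2|rewrite /p /q; char2].
  + by rewrite (_ : p + r = z + (w1 + w3)); [apply: nW; rewrite // !Wg.2|rewrite /p /r; char2].
  + by rewrite (_ : p + u + q = y + z + (w1 + u + w2)); [apply: nW; rewrite // !Wg.2|rewrite /p /q; char2].
  + by rewrite (_ : p + u + r = z + (w1 + u + w3)); [apply: nW; rewrite // !Wg.2|rewrite /p /r; char2].
  + by rewrite (_ : q + r = y + (w2 + w3)); [apply: nW; rewrite // !Wg.2|rewrite /q /r; char2].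
  + rewrite (_ : c + z + (w2 + u) + r = y + (w2 + u + w3)); last by rewrite /r; char2.
    by apply: nW; rewrite // !Wg.2.
- by move=> v; rewrite !inE => /or4P[] /eqP-> //; rewrite /p -addrA.
- by move=> v; rewrite e1 e2 e3 e4 !inE => /or4P[] /eqP-> //=; rewrite f0.
Qed.

(** * Subgroups of index 4 and gluing of cosets *)

(** W has index 4 in A, and 0, y, z, y + z represent its cosets. *)
Definition frame W A y z :=
  [/\ subgroup W, subgroup A, W \subset A, y \in A & z \in A] /\
  [/\ y \notin W, z \notin W, y + z \notin W &
    {in A, forall x, [|| x \in W, x + y \in W, x + z \in W | x + (y + z) \in W]}].

Lemma frameC W A y z : frame W A y z -> frame W A z y.
Proof.
move=> [[Wg Ag WA yA zA] [yW zW yzW cov]]; split; split=> //; first by rewrite addrC.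
by move=> x /cov; rewrite (addrC z) orbCA orbA orbCA -!orbA => /or4P[] ->; rewrite ?orbT.
Qed.

(** With [frameC], this lets any of the three nontrivial cosets play the role of y. *)
Lemma frameD W A y z : frame W A y z -> frame W A (y + z) z.
Proof.
move=> [[Wg Ag WA yA zA] [yW zW yzW cov]]; split; split=> //; rewrite ?addvK2 //.
  exact: Ag.2.
by move=> x /cov /or4P[] ->; rewrite ?orbT.
Qed.

(* The point 0 is excluded because [AI4_avoiding f] says nothing about [f 0]. *)
Definition half_const (f : V -> bool) A c := exists B q b,
  [/\ index2 B A, q \in A & {in B, forall x, c + q + x != 0 -> f (c + q + x) = b}].

Lemma frame_translate W A y z u v : frame W A y z -> u \in W -> v \in W ->
  frame W A (y + u) (z + v).
Proof.
move=> [[Wg Ag WA yA zA] [yW zW yzW cov]] uW vW.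
have uA := subsetP WA _ uW; have vA := subsetP WA _ vW.
have E : y + u + (z + v) = y + z + (u + v) by char2.
have uvW := Wg.2 _ _ uW vW.
pose DW := (subgroupDr _ Wg uW, subgroupDr _ Wg vW, subgroupDr _ Wg uvW).
split; split; rewrite ?E ?DW ?(subgroupDr _ Ag uA) ?(subgroupDr _ Ag vA) // => x.
by rewrite !(addrA x) !DW -(addrA x y z); apply: cov.
Qed.

(** Adjoining y and z adds nothing inside W, so an element v of W outside B stays outside and still
    serves as coset representative. *)
Lemma frame_index2 B W A y z : frame W A y z -> index2 B W ->
  index2 (adjoin (adjoin B y) z) A.
Proof.
move=> [[Wg Ag WA yA zA] [yW zW yzW cov]] [Bg BW [v /setDP[vW vB] vcov]].
split; first by do 2 apply: adjoin_subgroup.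
  by do 2 apply: adjoin_sub => //; apply: subset_trans WA.
have nB x : x \notin W -> (x \in B) = false by apply: contraNF; apply: subsetP.
exists v.
  rewrite !inE (subsetP WA) // andbT (negPf vB).
  by rewrite !nB // -?addrA subgroupDl // addrC.
have adjE x : (x \in adjoin (adjoin B y) z) =
    [|| x \in B, x + y \in B, x + z \in B | x + (y + z) \in B].
  by rewrite !inE -!orbA -(addrA x z) (addrC z).
move=> x /cov; rewrite !adjE !(addrAC x v).
by case/or4P => /vcov[] ->; rewrite ?orbT; [left|right|left|right|left|right|left|right].
Qed.

(** The two cosets of W form one coset of [adjoin W y], and z witnesses its index 2 in A. *)
Lemma frame_half_const f W A y z c q b : frame W A y z -> q \in A ->
  {in W, forall w, c + q + w != 0 -> f (c + q + w) = b} ->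
  {in W, forall w, c + (q + y) + w != 0 -> f (c + (q + y) + w) = b} -> half_const f A c.
Proof.
move=> [[Wg Ag WA yA zA] [yW zW yzW cov]] qA fq fqy.
exists (adjoin W y), q, b; split=> //.
  split; [exact: adjoin_subgroup|exact: adjoin_sub|].
  exists z; first by rewrite !inE zA (negPf zW) addrC (negPf yzW).
  move=> x xA; rewrite !inE -addrA (addrC z).
  by case/or4P: (cov x xA) => ->; rewrite ?orbT; [left|left|right|right].
move=> x; rewrite inE => /orP[]; first exact: fq.
move/fqy; rewrite (_ : c + (q + y) + (x + y) = c + q + x) //; char2.
Qed.

(** Of the four cosets of W, only that of c + (y + z) may contain 0. An empty trace, or two full
    ones, gives two cosets with the same value; otherwise half of each coset is used. *)
Lemma frame_step f W A c y z : AI4_avoiding f -> frame W A y z ->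
  {in W, forall w, f (c + w) = false} -> c \notin W -> c + y \notin W -> c + z \notin W ->
  half_const f A c.
Proof.
move=> fP F f0 cW cyW czW; have [[Wg Ag WA yA zA] [yW zW yzW cov]] := F.
have yzA := Ag.2 _ _ yA zA.
pose Y := trace W f c y; pose Z := trace W f c z; pose T := trace W f c (y + z).
have hc0 x (X := trace W f c x) : X = set0 -> {in W, forall w, c + x + w != 0 -> f (c + x + w) = false}.
  move=> X0 w wW; rewrite addv_eq0 eq_sym => wh; apply: negbTE; apply/negP => fw.
  by suff: w \in X; [rewrite X0 inE|rewrite inE wW wh].
have hc1 x (X := trace W f c x) : W :\ (c + x) \subset X -> {in W, forall w, c + x + w != 0 -> f (c + x + w) = true}.
  move=> /subsetP WX w wW; rewrite addv_eq0 eq_sym => wh.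
  by have := WX w; rewrite !inE wW wh => /(_ isT).
have f00 : {in W, forall w, c + 0 + w != 0 -> f (c + 0 + w) = false}.
  by move=> w wW _; rewrite addr0 f0.
have [Y0|Y0] := eqVneq Y set0.
  by apply: (frame_half_const F Ag.1 f00); rewrite add0r; apply: hc0.
have [Z0|Z0] := eqVneq Z set0.
  by apply: (frame_half_const (frameC F) Ag.1 f00); rewrite add0r; apply: hc0.
have [T0|T0] := eqVneq T set0.
  by apply: (frame_half_const (frameD F) Ag.1 f00); rewrite add0r; apply: hc0.
have sW x : trace W f c x \subset W by apply/subsetP => w; rewrite inE => /and3P[].
have ff x : W \subset trace W f c x -> W :\ (c + x) \subset trace W f c x.
  by apply: subset_trans; apply: subsetDl.
have hT : c + (y + z) \notin T by rewrite inE eqxx andbF.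
have [|||[/ff/hc1 fY /ff/hc1 fZ]|[/ff/hc1 fY /hc1 fT]|[/ff/hc1 fZ /hc1 fT]|[S [Sg SW dS]]] :=
  full_or_common Wg (sW y) (sW z) (sW (y + z)) cyW czW hT Y0 Z0 T0.
- move=> u /diff_trace; rewrite -/Y -/Z -/T => /(_ z fP Wg f0 cW yzW zW).
  by rewrite addvK2 => /(_ yW)[]; [right|left].
- by move=> u /diff_trace; rewrite -/Y -/Z -/T => /(_ z fP Wg f0 cW yW zW yzW)[]; [right|left].
- move=> u /diff_trace; rewrite -/Y -/Z -/T => /(_ y fP Wg f0 cW zW yW).
  by rewrite (addrC z) => /(_ yzW)[]; [right|left].
- apply: (frame_half_const (frameD F) yA fY).
  by rewrite (_ : y + (y + z) = z) //; char2.
- exact: (frame_half_const (frameC F) yA fY).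
- apply: (frame_half_const F zA fZ).
  by rewrite (addrC z).
have [B Bi SB] := index2_above Sg Wg SW.
have [Bg _ [v /setDP[vW vB] _]] := Bi.
(* The differences of X lie in B, so X is inside one coset of B in W and misses the other. *)
have gap X : X \subset W -> X != set0 -> (forall u, diff X u -> u \in S) ->
    exists2 a, a \in W & {in B, forall w, a + w \notin X}.
  move=> XW /set0Pn[x xX] dX; exists (x + v); first by rewrite Wg.2 // (subsetP XW).
  move=> w wB; apply: contraNN vB => xvwX.
  rewrite -(subgroupDr _ Bg wB); apply/(subsetP SB)/dX; exists x => //.
  by rewrite addrA.
have [a1 a1W aY] : exists2 a, a \in W & {in B, forall w, a + w \notin Y}.
  by apply: (gap _ (sW y) Y0) => u du; apply: dS; left.
have [a2 a2W aZ] : exists2 a, a \in W & {in B, forall w, a + w \notin Z}.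
  by apply: (gap _ (sW z) Z0) => u du; apply: dS; right; left.
have [a3 a3W aT] : exists2 a, a \in W & {in B, forall w, a + w \notin T}.
  by apply: (gap _ (sW (y + z)) T0) => u du; apply: dS; right; right.
have BW : B \subset W by case: Bi.
have hX x a w : a \in W -> w \in B -> a + w \notin trace W f c x ->
    c + x + (a + w) != 0 -> f (c + x + (a + w)) = false.
  move=> aW wB; rewrite inE Wg.2 // ?(subsetP BW) //= addv_eq0 eq_sym.
  by move=> aw ne; move: aw; rewrite ne => /negbTE.
(* With q the translate and y', z' the new representatives, q + y' = y + a1, q + z' = z + a2 and q +
   y' + z' = y + z + a3. In the coset c + W any half will do, as f vanishes there. *)
exists (adjoin (adjoin B (y + (a2 + a3))) (z + (a1 + a3))), (a1 + a2 + a3), false; split.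
- by apply: frame_index2 Bi; apply: frame_translate; rewrite ?Wg.2.
- by apply: (subsetP WA); rewrite !Wg.2.
move=> x; rewrite !inE => /orP[/orP[]|/orP[]] xB.
- by rewrite -addrA f0 // !Wg.2 // (subsetP BW).
- have -> : c + (a1 + a2 + a3) + x = c + y + (a1 + (x + (y + (a2 + a3)))) by char2.
  exact/hX/aY.
- have -> : c + (a1 + a2 + a3) + x = c + z + (a2 + (x + (z + (a1 + a3)))) by char2.
  exact/hX/aZ.
- have -> : c + (a1 + a2 + a3) + x =
    c + (y + z) + (a3 + (x + (z + (a1 + a3)) + (y + (a2 + a3)))) by char2.
  exact/hX/aT.
Qed.

(** * The induction on the subgroup *)

Lemma AI4_avoiding_compl f : AI4_avoiding f -> AI4_avoiding (fun x => ~~ f x).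
Proof.
move=> fP b x y z t fr H1 H2; apply: (fP (~~ b) x y z t fr) => u uS.
- by rewrite -(H1 u uS) negbK.
- by rewrite -(H2 u uS) negbK.
Qed.

Lemma half_const_compl f A c : half_const (fun x => ~~ f x) A c -> half_const f A c.
Proof.
move=> [B [q [b [Bi qA fB]]]]; exists B, q, (~~ b); split=> // x xB x0.
by rewrite -(fB x xB x0) negbK.
Qed.

Lemma half_const_shift f A c a : subgroup A -> a \in A ->
  half_const f A (c + a) -> half_const f A c.
Proof.
move=> Ag aA [B [q [b [Bi qA fB]]]]; exists B, (a + q), b.
by split=> //; [apply: Ag.2|rewrite addrA].
Qed.

Lemma avoiding_half_const f A c : AI4_avoiding f -> subgroup A -> A != [set 0] ->
  half_const f A c.
Proof.
move=> fP; have [m] := ubnP #|A|; elim: m => // m IHm in A c *; rewrite ltnS => Am Ag A0.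
have sub0 S : subgroup S -> [set 0] \subset S by case=> S0 _; rewrite sub1set.
have g0 : subgroup [set 0] by split=> [|x y /set1P-> /set1P->]; rewrite ?addr0 set11.
have [|B0 B0i _] := @index2_above [set 0] A g0 Ag.
  by rewrite properEneq eq_sym A0 sub0.
have [B0g B0A [v /setDP[vA vB0] _]] := B0i.
(* If A has order 2, half of a coset is a single point. *)
have [B00|B00] := eqVneq B0 [set 0].
  exists B0, 0, (f c); split=> //; first exact: Ag.1.
  by move=> x; rewrite B00 => /set1P-> _; rewrite !addr0.
(* Move to a coset of [B0] missing 0, so that the constancy given by induction has no exception. *)
have [a aA caB0] : exists2 a, a \in A & c + a \notin B0.
  have [cB0|cB0] := boolP (c \in B0); last by exists 0; rewrite ?addr0 ?Ag.1.
  by exists v; rewrite // subgroupDl.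
apply: (half_const_shift Ag aA); move: (c + a) caB0 => {}c cB0.
have [|W [q [b [Wi qB0 fW]]]] := IHm B0 c _ B0g B00.
  apply: leq_trans Am; apply: proper_card; rewrite properE B0A.
  by apply/subsetPn; exists v.
have qA := subsetP B0A _ qB0.
apply: (half_const_shift Ag qA); have : c + q \notin B0 by rewrite subgroupDr.
move: (c + q) fW => {}c fW {}cB0.
have [Wg WB0 [y /setDP[yB0 yW] ycov]] := Wi.
have nW x : x \notin B0 -> x \notin W by apply: contraNN; apply: subsetP.
have cW : {in W, forall w, c + w != 0}.
  move=> w wW; apply: contraNneq cB0 => /eqP; rewrite addv_eq0 => /eqP->.
  exact: (subsetP WB0).
(* If c is in A, then z = c + y puts 0 in the coset of c + (y + z), the one allowed to contain it.
   Otherwise c + A misses 0 and v will do. *)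
have [z [zA zB0 czW]] : exists z, [/\ z \in A, z \notin B0 & c + z \notin W].
  have [cA|cA] := boolP (c \in A).
    have yA := subsetP B0A _ yB0.
    exists (c + y); split; first exact: Ag.2.
      by rewrite subgroupDr.
    by rewrite addrA addvv add0r.
  exists v; split=> //; apply: contraNN cA => /(subsetP WB0)/(subsetP B0A).
  by rewrite subgroupDr.
have F : frame W A y z.
  split; split=> //; [exact: subset_trans B0A|exact: (subsetP B0A)|exact: nW| |].
    by apply: nW; rewrite subgroupDl.
  move=> x xA; have [xB0|xzB0] := index2_cover Ag B0i zA zB0 xA.
    by case: (ycov x xB0) => ->; rewrite ?orbT.
  by rewrite (addrC y) addrA; case: (ycov _ xzB0) => ->; rewrite ?orbT.
have cyW : c + y \notin W by apply: nW; rewrite subgroupDr.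
have {}fW : {in W, forall w, f (c + w) = b} by move=> w wW; rewrite fW ?cW.
case: b fW => fW; last exact: (frame_step fP F fW (nW _ cB0)).
apply: half_const_compl.
apply: (frame_step (AI4_avoiding_compl fP) F _ (nW _ cB0)) => // w wW.
by rewrite fW.
Qed.

(** * Hyperplanes and the theorem *)

Lemma subgroup_vspace S : subgroup S -> exists U : {vspace V}, S = [set x | x \in U].
Proof.
move=> Sg; exists <<enum S>>%VS; apply/setP => x; rewrite inE.
apply/idP/idP => [xS|]; first by apply: memv_span; rewrite mem_enum.
move=> /(coord_span (X := in_tuple (enum S)))->.
apply: (big_ind (fun u => u \in S)) => [||i _]; [exact: Sg.1|exact: Sg.2|].
have : (enum S)`_i \in S by rewrite -mem_enum mem_nth.
by case: (F2_cases (coord (in_tuple (enum S)) i x)) => ->; rewrite ?scale0r ?scale1r ?Sg.1.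
Qed.

Lemma setT_subgroup : subgroup setT.
Proof. by split=> [|x y _ _]; rewrite inE. Qed.

(** A flat containing the nonzero points of B and a point x outside B also contains those of x + B,
    hence everything. *)
Lemma index2_hyperplane B : index2 B setT -> hyperplane (B :\ 0).
Proof.
move=> Bi; have [Bg _ [v /setDP[_ vB] cov]] := Bi.
have v0 : v != 0 by apply: contraNneq vB => ->; case: Bg.
have [U BU] := subgroup_vspace Bg.
split.
- split; first by apply/subsetP => x; rewrite !inE => /andP[].
  by exists U; rewrite setD1K //; case: Bg.
- rewrite properE; apply/andP; split; first by apply/subsetP => x; rewrite !inE => /andP[].
  by apply/subsetPn; exists v; rewrite !inE ?v0 ?(negPf vB).
- move=> F [FG [U' FU']] /properP[_ [p pG pF]] BF.
  have FE x : (x \in F) = (x != 0) && (x \in U').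
    have := FU' => /setP/(_ x); rewrite !inE.
    case: (eqVneq x 0) => //= -> _.
    by apply/negP => /(subsetP FG); rewrite inE eqxx.
  have BU' x : x \in B -> x \in U'.
    move=> xB; have [->|x0] := eqVneq x 0; first exact: mem0v.
    by have := subsetP BF x; rewrite !inE x0 xB FE => /(_ isT)/andP[].
  apply/eqP; rewrite eqEsubset BF andbT; apply/subsetP => x; rewrite FE !inE => /andP[-> xU'].
  apply: contraNT pF => xB; rewrite inE in pG; rewrite FE pG /=.
  have [/BU'//|/BU' pxU'] := index2_cover setT_subgroup Bi (in_setT x) xB (in_setT p).
  by rewrite -[p](addvK2 p x) memvD.
Qed.

(** In characteristic 2, passing to the triple sums is an involution, hence invertible. *)
Lemma free4_triples x y z (t : V) : free [:: x; y; z; t] ->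
  free [:: x + y + z; x + y + t; x + z + t; y + z + t].
Proof.
move=> /free4P fr; apply/free4P => a b c d e.
have [] := fr (a + b + c) (a + b + d) (a + c + d) (b + c + d).
  by rewrite -e; apply/rowP => i; rewrite !mxE; ring.
by case: (F2_cases a) => ->; case: (F2_cases b) => ->;
  case: (F2_cases c) => ->; case: (F2_cases d) => ->.
Qed.

Lemma AI4_free_avoiding (E : {set V}) : AI4_free E -> AI4_avoiding (mem E).
Proof.
move=> EP.
have key x y z t : free [:: x; y; z; t] -> {subset [:: x; y; z; t] <= E} ->
    has (mem E) [:: x + y + z; x + y + t; x + z + t; y + z + t].
  move=> fr sE; have [i] := EP [tuple x; y; z; t] fr sE.
  rewrite big_mkcond !big_ord_recl big_ord0 /= !(tnth_nth 0) /=.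
  by case: i => -[|[|[|[|//]]]] ?; rewrite /= ?add0r ?addr0 ?addrA => ->; rewrite ?orbT.
move=> [] x y z t fr H1 H2.
  have /hasP[u /H2 + uE] : has (mem E) [:: x + y + z; x + y + t; x + z + t; y + z + t].
    by apply: key => // u /H1.
  by rewrite uE.
(* For [b] false, the triple sums lie in E, and their own triple sums are x, y, z, t again. *)
have /hasP[u] := key _ _ _ _ (free4_triples fr) (fun u uS => H2 u uS).
rewrite (_ : x + y + z + (x + y + t) + (x + z + t) = x); last by char2.
rewrite (_ : x + y + z + (x + y + t) + (y + z + t) = y); last by char2.
rewrite (_ : x + y + z + (x + z + t) + (y + z + t) = z); last by char2.
rewrite (_ : x + y + t + (x + z + t) + (y + z + t) = t); last by char2.
by move=> /H1 + uE; rewrite uE.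
Qed.

End Subgroups.

Theorem lemma4p1 (n : nat) (n_ge1 : (1 <= n)%N) (E : {set 'rV['F_2]_n})
    (E_sub : E \subset PG n) (E_free : AI4_free E) :
  exists H : {set 'rV['F_2]_n},
    hyperplane H /\
    [\/ E \subset H,
        PG n :\: E \subset H,
        E :&: H = set0
      | H \subset E].
Proof.
have T0 : [set: 'rV['F_2]_n] != [set 0].
  apply/eqP => /setP/(_ (const_mx 1)); rewrite !inE => /esym/eqP/rowP/(_ (Ordinal n_ge1)).
  by rewrite !mxE => /eqP; rewrite oner_eq0.
have [B [q [b [Bi _ EB]]]] :=
  avoiding_half_const 0 (AI4_free_avoiding E_free) (setT_subgroup n) T0.
have [Bg _ _] := Bi.
have {}EB x : x + q \in B -> x != 0 -> (x \in E) = b.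
  by move=> xqB; have := EB _ xqB; rewrite add0r [q + _]addrC addvK2; apply.
exists (B :\ 0); split; first exact: index2_hyperplane.
(* The half on which E is constant is either B itself or its complement; this separates the last two
   alternatives from the first two. *)
have [qB|qB] := boolP (q \in B).
  have {}EB x : x \in B :\ 0 -> (x \in E) = b.
    by rewrite !inE => /andP[x0 xB]; apply: EB => //; rewrite Bg.2.
  case: b EB => EB; [constructor 4|constructor 3].
    by apply/subsetP => x /EB.
  by apply/setP => x; rewrite !inE andbC; apply/negP => /andP[xB]; rewrite EB ?inE.
have {}EB x : x != 0 -> x \notin B -> (x \in E) = b.
  move=> x0 xB; apply: EB => //.
  by case: (index2_cover (setT_subgroup n) Bi (in_setT q) qB (in_setT x)) => // /idPn[].
case: b EB => EB; [constructor 2|constructor 1]; apply/subsetP => x.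
  by rewrite !inE => /andP[xE x0]; rewrite x0; apply: contraNT xE => /(EB _ x0)->.
move=> xE; have := subsetP E_sub _ xE; rewrite !inE => x0; rewrite x0.
by apply/idPn => /(EB _ x0); rewrite xE.
Qed.
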